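(* Let $\mathcal{M}=(S,r)$ be a loop-free finitary matroid and $\kappa$ an infinite cardinal. Then the following are equivalent: (1) $Chr(\mathcal{M})\le\kappa$; (2) $List(\mathcal{M})\le\kappa$; (3) there is a well-ordered base $(B,\le)$ of $\mathcal{M}$ such that for every $b\in B$, $|\{x\in S : M_B(x)=b\}|\le\kappa$.
   Context: A finitary matroid is a pair $\mathcal{M}=(S,r)$, where $S$ is a set and $r:[S]^{<\omega}\to\omega$ is defined on the finite subsets of $S$ and satisfies: $r(\emptyset)=0$; $A\subseteq B$ implies $r(A)\le r(B)$; $r(A)\le |A|$; and $r(A)+r(B)\ge r(A\cap B)+r(A\cup B)$ for all finite $A,B\subseteq S$. A set $X\subseteq S$ is independent if $r(A)=|A|$ for every finite $A\subseteq X$; a circuit is a minimal non-independent subset; a base is a maximal independent set. $\mathcal{M}$ is loop-free if $r(\{x\})=1$ for all $x\in S$. If $B$ is a base and $x\in S\setminus B$, there is a unique circuit contained in $B\cup\{x\}$, called the main circle $C(B,x)$. A well-ordered base is a pair $(B,\le)$ with $B$ a base and $\le$ a well-order on $B$; for it define $M_B:S\to B$ by $M_B(x)=x$ if $x\in B$ and $M_B(x)=\max_{\le}(C(B,x)\cap B)$ if $x\notin B$. A proper coloring of $\mathcal{M}$ by a color set $K$ is a map $\Phi:S\to K$ with every $\Phi^{-1}(i)$ independent. $Chr(\mathcal{M})$ is the least cardinal $\kappa$ such that a proper coloring $S\to\kappa$ exists. A $\kappa$-listing is a function $L$ on $S$ with $|L(x)|\ge\kappa$ for all $x$; an $L$-coloring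 is a proper coloring $\Phi$ with $\Phi(x)\in L(x)$ for all $x$; $List(\mathcal{M})$ is the least cardinal $\kappa$ such that an $L$-coloring exists for every $\kappa$-listing $L$. *)

(* Defs.v *)
From HB Require Import structures.
From mathcomp Require Import all_boot finmap.
From mathcomp Require Import all_classical wochoice.
Set Implicit Arguments.
Unset Strict Implicit.
Unset Printing Implicit Defensive.

Local Open Scope classical_set_scope.
Local Open Scope card_scope.

(* The ground set is the whole type S. Requiring a choiceType, which is needed
   for {fset S}, is no restriction: classically every type is one. *)
Record finitary_matroid (S : choiceType) := FinitaryMatroid {
  rank :> {fset S} -> nat ;
  rank0 : rank fset0 = 0 ;
  rank_mono : forall A B : {fset S}, (A `<=` B)%fset -> rank A <= rank B ;
  rank_card : forall A : {fset S}, rank A <= #|` A| ;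
  rank_submod : forall A B : {fset S},
    rank (A `&` B)%fset + rank (A `|` B)%fset <= rank A + rank B }.

Section Matroid.
Variables (S : choiceType) (M : finitary_matroid S).

Definition loop_free := forall x : S, M [fset x]%fset = 1.

Definition independent (X : set S) :=
  forall A : {fset S}, [set` A] `<=` X -> M A = #|` A|.

Definition circuit (C : set S) :=
  ~ independent C /\ forall D : set S, D `<=` C -> ~ independent D -> D = C.

Definition base (B : set S) :=
  independent B /\ forall X : set S, independent X -> B `<=` X -> X = B.

(* Only the restriction of le to B is constrained. *)
Definition well_ordered_base (B : set S) (le : rel S) :=
  base B /\ wo_chain le (mem B).

(* The default value set0 is relevant only if no such circuit exists, which
   cannot happen when B is a base and x is not in B. *)
Definition main_circle (B : set S) (x : S) : set S :=
  xget set0 [set C | circuit C /\ C `<=` x |` B].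

(* M_B, with values viewed in S. The default value x of xget is relevant only
   if main_circle B x `&` B has no maximum; in a loop-free matroid that set is
   finite and nonempty for every base B and every x outside B. *)
Definition main_max (B : set S) (le : rel S) (x : S) : S :=
  if x \in B then x
  else xget x [set m | maximum_of le (mem (main_circle B x `&` B)) m].

Definition proper_coloring (K : Type) (Phi : S -> K) :=
  forall i : K, independent (Phi @^-1` [set i]).

Definition colorable (K : Type) := exists Phi : S -> K, proper_coloring Phi.

(* The colors of a listing may come from an arbitrary type C. *)
Definition listing (K C : Type) (L : S -> set C) :=
  forall x : S, [set: K] #<= L x.

Definition list_coloring (C : Type) (L : S -> set C) (Phi : S -> C) :=
  proper_coloring Phi /\ forall x : S, L x (Phi x).

Definition list_colorable (K : Type) :=
  forall (C : Type) (L : S -> set C), listing K L ->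
    exists Phi : S -> C, list_coloring L Phi.

End Matroid.

(* A cardinal is represented by any type having that cardinality. *)
Definition is_least_cardinal (P : Type -> Prop) (K : Type) :=
  P K /\ forall K' : Type, P K' -> [set: K] #<= [set: K'].

Definition is_Chr (S : choiceType) (M : finitary_matroid S) (K : Type) :=
  is_least_cardinal (colorable M) K.

Definition is_List (S : choiceType) (M : finitary_matroid S) (K : Type) :=
  is_least_cardinal (list_colorable M) K.

Definition Chr_le (S : choiceType) (M : finitary_matroid S) (K : Type) :=
  exists2 K0 : Type, is_Chr M K0 & [set: K0] #<= [set: K].

Definition List_le (S : choiceType) (M : finitary_matroid S) (K : Type) :=
  exists2 K0 : Type, is_List M K0 & [set: K0] #<= [set: K].

(* Main.v *)
(* For (1) => (3), extend each color class to a base B_i. A set closed under all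
   B_i-supports is a flat, and the closure of a point under them has at most K
   elements. The stage of a point is the least x whose closure contains it, so
   that each stage has at most K points. Well-order the ground set by stages:
   any B_i then works, since x and M_B(x) always have the same stage.
   For (3) => (2), choose colors greedily so that they are distinct on each
   fiber of M_B; then M_B is injective on every color class, and this forces
   independence. *)
From Stdlib Require Import Wellfounded.
Require Import Defs.
From mathcomp Require Import all_boot finmap.
From mathcomp Require Import all_classical wochoice.
From mathcomp Require Import zify.
Set Implicit Arguments.
Unset Strict Implicit.
Unset Printing Implicit Defensive.
Local Open Scope classical_set_scope.
Local Open Scope card_scope.

(** * Well-orders *)

Lemma wo_chain_transitive (T : eqType) (R : rel T) (C : {pred T}) :
  wo_chain R C -> {in C & &, transitive R}.
Proof.
move=> Rwo y x z Cy Cx Cz Rxy Ryz.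
have Ranti := wo_chain_antisymmetric Rwo.
have [||w [[]]] := Rwo (mem [:: x; y; z]).
- by move=> t; rewrite !inE => /or3P[]/eqP->.
- by exists x; rewrite mem_head.
rewrite !inE => /or3P[]/eqP-> lb _.
- by apply: lb; rewrite !inE eqxx !orbT.
- suff -> : x = y by [].
  by apply: Ranti => //; rewrite Rxy lb // mem_head.
- suff <- : y = z by [].
  by apply: Ranti => //; rewrite Ryz lb // !inE eqxx !orbT.
Qed.

Lemma wo_chain_finite_maximum (T : eqType) (R : rel T) (C : {pred T})
    (A : set T) :
  wo_chain R C -> finite_set A -> A !=set0 -> {subset A <= C} ->
  exists m, maximum_of R (mem A) m.
Proof.
move=> Rwo /finite_seqP[s ->]; have Rtr := wo_chain_transitive Rwo.
have Rxx := wo_chain_reflexive Rwo; have Rtot := wo_chainW Rwo.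
elim: s => [[]//|x [|y s] IH] _ sC.
  exists x; split=> [|t]; rewrite !inE /= !inE // => /eqP->.
  by apply/Rxx/sC/mem_set/mem_head.
have sub t : t \in y :: s -> t \in x :: y :: s.
  by move=> ts; rewrite in_cons ts orbT.
have [||m [/set_mem ms mub]] := IH; first by exists y; exact: mem_head.
  by move=> t /set_mem/sub ts; apply/sC/mem_set.
have Cx : x \in C by apply/sC/mem_set/mem_head.
have Cm : m \in C by apply/sC/mem_set/sub.
have ubP w : R x w -> R m w -> w \in C ->
    upper_bound R (mem [set` x :: y :: s]) w.
  move=> xw mw Cw t /[dup]/sC Ct /set_mem; rewrite /= in_cons.
  move=> /orP[/eqP->//|ts].
  by apply: (Rtr m) => //; exact/mub/mem_set.
have /orP[xm|mx] := Rtot _ _ Cx Cm.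
  by exists m; split; [exact/mem_set/sub|apply: ubP => //; exact: Rxx].
by exists x; split; [exact/mem_set/mem_head|apply: ubP => //; exact: Rxx].
Qed.

Definition strict (T : eqType) (R : rel T) : rel T :=
  fun x y => (x != y) && R x y.

Section WellOrder.
Variables (T : eqType) (R : rel T).
Hypothesis Rwo : well_order R.
Implicit Types (x y : T).

Let Rch : wo_chain R predT.
Proof. exact: withinW. Qed.

Lemma well_order_refl x : R x x.
Proof. exact: (wo_chain_reflexive Rch). Qed.

Lemma well_order_anti : antisymmetric R.
Proof. by move=> x y; apply: (wo_chain_antisymmetric Rch). Qed.

Lemma well_order_trans : transitive R.
Proof. by move=> y x z; apply: (wo_chain_transitive Rch). Qed.

Lemma well_order_total : total R.
Proof. by move=> x y; apply: (wo_chainW Rch). Qed.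

Lemma well_order_minimum (A : set T) :
  A !=set0 -> exists2 x, A x & forall y, A y -> R x y.
Proof.
move=> [a Aa]; have [|x [[/set_mem Ax xlb] _]] := Rwo (A := mem A).
  by exists a; exact/mem_set.
by exists x => // y /mem_set/xlb.
Qed.

Lemma strict_well_founded : well_founded (strict R).
Proof.
move=> x; apply: contrapT => nx.
have [|y nAy ymin] := @well_order_minimum [set y | ~ Acc (strict R) y].
  by exists x.
apply: nAy; constructor => z /andP[nzy zy]; apply: contrapT => /ymin yz.
by move/eqP: nzy; apply; apply: well_order_anti; rewrite zy.
Qed.

Lemma strict_total x y : x <> y -> strict R x y \/ strict R y x.
Proof.
move=> /eqP nxy; rewrite /strict nxy eq_sym nxy.
by have /orP[] := well_order_total x y; [left|right].
Qed.

End WellOrder.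

Definition lexi (T U : eqType) (h : T -> U) (R : rel U) (Q : rel T) : rel T :=
  fun x y => R (h x) (h y) && ((h x == h y) ==> Q x y).

Lemma lexi_well_order (T U : eqType) (h : T -> U) (R : rel U) (Q : rel T) :
  well_order R -> well_order Q -> well_order (lexi h R Q).
Proof.
move=> Rwo Qwo; apply: antisymmetric_well_order => [x y|A [a Aa]].
  move=> /andP[/andP[Rxy Qxy] /andP[Ryx Qyx]].
  have hxy : h x = h y by apply: (well_order_anti Rwo); rewrite Rxy.
  by apply: (well_order_anti Qwo); move: Qxy Qyx; rewrite hxy eqxx /= => -> ->.
have [|_ [x Ax <-] xmin] :=
  well_order_minimum Rwo (A := h @` [set x | x \in A]).
  by exists (h a), a.
have [|y [Ay hyx] ymin] :=
  well_order_minimum Qwo (A := [set y | y \in A /\ h y = h x]).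
  by exists x.
exists y; split=> // z Az; rewrite /lexi hyx xmin /=; last by exists z.
by apply/implyP => /eqP hxz; apply: ymin.
Qed.

(** * Cardinals *)

Lemma card_le_setTP (T U : Type) (B : set U) :
  [set: T] #<= B <-> exists2 f : T -> U, (forall x, B (f x)) & injective f.
Proof.
split=> [/card_leP[f]|[f fB finj]]; last first.
  rewrite -(card_le_eql (inj_card_eq (in2W finj))).
  by apply: subset_card_le => _ [x _ <-].
pose g x := f (SigSub (mem_set (I : [set: T] x))).
exists (val \o g) => [x|x y /val_inj]; first exact: set_valP.
by move/(@inj _ _ _ f) => fgxy; have [] := fgxy (in_setT _) (in_setT _).
Qed.

Lemma greedy_choice (T C : Type) (lt : T -> T -> Prop) (L : T -> set C) :
  well_founded lt -> (forall x, ~ (L x #<= [set y | lt y x])) ->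
  exists2 f : T -> C, forall x, L x (f x) & forall x y, lt x y -> f x <> f y.
Proof.
move=> wf big.
pose used x (f : forall y, lt y x -> C) : set C :=
  range (fun u : [set y | lt y x] => f (val u) (set_valP u)).
have fresh x f : exists c, L x c /\ ~ used x f c.
  apply: contrapT => nc; apply: (big x).
  apply: (@card_le_trans _ _ _ (used x f)).
    apply: subset_card_le => c Lc.
    by apply: contrapT => nu; apply: nc; exists c.
  by rewrite -(card_le_eqr (card_setT _)); exact: card_image_le.
pose next x f := projT1 (cid (fresh x f)).
pose f := Fix wf (fun=> C) next.
have fE x : f x = next x (fun y _ => f y).
  apply: (Fix_eq wf (fun=> C)) => {}x g h gh; congr next.
  by apply/functional_extensionality_dep => y; apply/funext => yx; exact: gh.
have fP x : L x (f x) /\ ~ used x (fun y _ => f y) (f x).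
  by rewrite [f x]fE /next; case: cid.
exists f => [x|x y xy]; first by have [] := fP x.
have [_ fy_fresh] := fP y => fxy; apply: fy_fresh.
by exists (SigSub (mem_set (xy : [set z | lt z y] x))).
Qed.

Lemma card_le_or_segment (T U : Type) (lt : T -> T -> Prop) :
  well_founded lt -> (forall x y, x <> y -> lt x y \/ lt y x) ->
  [set: T] #<= [set: U] \/ exists x, [set: U] #<= [set y | lt y x].
Proof.
move=> wf tot.
have [|/forallNP big] := pselect (exists x, [set: U] #<= [set y | lt y x]).
  by right.
have [f _ fneq] := greedy_choice (L := fun=> [set: U]) wf big.
left; apply/card_le_setTP; exists f => // x y fxy.
by apply: contrapT => /tot[] /fneq; rewrite fxy.
Qed.

Definition card_lt (U T : Type) : Prop := ~ ([set: T] #<= [set: U]).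

Lemma card_lt_well_founded : well_founded card_lt.
Proof.
elim/Peq=> T; have [R Rwo] := well_ordering_principle T.
have wf := strict_well_founded Rwo.
suff acc_seg x U : [set: U] #<= [set y | strict R y x] -> Acc card_lt U.
  constructor=> U nTU.
  have [//|[x]] := card_le_or_segment U wf (strict_total Rwo).
  exact: acc_seg.
elim/(well_founded_ind wf): x U => x IH U Ux; constructor => V nUV.
pose lt (y z : [set y | strict R y x]) := strict R (val y) (val z).
have [||xV|[y Vy]] := @card_le_or_segment _ V lt.
- exact: (wf_inverse_image _ _ (strict R) val wf).
- by move=> y z nyz; apply: (strict_total Rwo) => /val_inj.
- case: nUV; apply: card_le_trans Ux _.
  by rewrite -(card_le_eql (card_setT _)).
- apply: (IH (val y)); first exact: (set_valP y).
  have /card_le_setTP[f fy finj] := Vy.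
  apply/card_le_setTP; exists (val \o f) => [v|v w /val_inj/finj//].
  exact: fy.
Qed.

Lemma initial_well_order (T : eqType) : exists2 R : rel T, well_order R &
  forall x, ~ ([set: T] #<= [set y | strict R y x]).
Proof.
have [R Rwo] := well_ordering_principle T.
pose big := [set x | [set: T] #<= [set y | strict R y x]].
have [/(well_order_minimum Rwo)[x Tx xmin]|/forallNP noseg] :=
  pselect (big !=set0); last by exists R.
have /card_le_setTP[j jx jinj] := Tx.
(* As j is injective, [lexi j R R] is the pullback of R along j. *)
exists (lexi j R R) => [|y Ty]; first exact: lexi_well_order.
have /andP[/eqP jyx Rjyx] := jx y; apply: jyx.
apply: (well_order_anti Rwo); rewrite Rjyx xmin //=.
have /card_le_setTP[f fy finj] := Ty; apply/card_le_setTP.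
exists (j \o f) => [z|z w /jinj/finj//].
by have /andP[fz /andP[jz _]] := fy z; rewrite /= /strict (inj_eq jinj) fz jz.
Qed.

Lemma card_setU1_le (T : Type) (A : set T) (x : T) :
  infinite_set A -> x |` A #<= A.
Proof.
move=> /infiniteP/card_le_setTP[e eA einj].
have /choice[g gP] : forall z, exists w, [/\ z = e 0 -> w = x,
    forall k, z = e k.+1 -> w = e k & (forall k, z <> e k) -> w = z].
  move=> z; have [[[|k] ->]|/forallNP nz] := pselect (exists k, z = e k).
  - by exists x; split=> [//|k /einj|/(_ 0)].
  - by exists (e k); split=> [/einj|k' /einj[->]|/(_ k.+1)].
  - by exists z; split=> // [/nz|k /nz].
apply: card_le_trans (card_image_le g A); apply: subset_card_le => z [->|Az].
  by exists (e 0); [exact: eA|have [->] := gP (e 0)].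
have [[k ->]|/forallNP nz] := pselect (exists k, z = e k).
  by exists (e k.+1); [exact: eA|have [_ /(_ k)-> //] := gP (e k.+1)].
by exists z => //; have [_ _ ->] := gP z.
Qed.

Lemma infinite_initial_well_order (T : eqType) : infinite_set [set: T] ->
  exists2 R : rel T, well_order R & forall x, ~ ([set: T] #<= [set y | R y x]).
Proof.
move=> infT; have [R Rwo noseg] := initial_well_order T; exists R => // x.
have -> : [set y | R y x] = x |` [set y | strict R y x].
  apply/seteqP; split=> y /=; rewrite /strict.
    by have [->|_] := eqVneq y x; [left|right].
  by move=> [->|/andP[]//]; exact: well_order_refl.
have [finx|infx] := pselect (finite_set [set y | strict R y x]).
  move=> /card_le_finite finT; apply: infT; apply: finT.
  by rewrite finite_setU; split.
by move=> /card_le_trans/(_ (card_setU1_le _ infx)); exact: noseg.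
Qed.

(* In an order of K * K by the maximum of the components, every initial segment
   lies in the square of an initial segment of K. *)
Lemma card_prod_le (K : Type) :
  infinite_set [set: K] -> [set: K * K] #<= [set: K].
Proof.
elim/(well_founded_ind card_lt_well_founded): K; elim/Peq=> K IH infK.
have [R Rwo noseg] := infinite_initial_well_order infK.
have [Q Qwo] := well_ordering_principle (K * K)%type.
pose max (p : K * K) := if R p.1 p.2 then p.2 else p.1.
have lexi_wo := lexi_well_order max Rwo Qwo.
have [//|[p Kp]] :=
  card_le_or_segment K (strict_well_founded lexi_wo) (strict_total lexi_wo).
pose U := [set z | R z (max p)].
have {}Kp : [set: K] #<= U `*` U.
  apply: card_le_trans Kp _; apply: subset_card_le => q /andP[_ /andP[+ _]].
  rewrite /U /= [max q]/max; have [q12|] := boolP (R q.1 q.2).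
    by move=> qp; split=> //; exact: (well_order_trans Rwo q12).
  have /orP[->//|q21 _ qp] := well_order_total Rwo q.1 q.2.
  by split=> //; exact: (well_order_trans Rwo q21).
have [finU|infU] := pselect (finite_set U).
  by case: infK; apply: card_le_finite Kp _; exact: finite_setX.
have UU : U `*` U `<=` range (fun u : U * U => (val u.1, val u.2)).
  by move=> [z w] [/= zU wU]; exists (SigSub (mem_set zU), SigSub (mem_set wU)).
case: (noseg (max p)); apply: card_le_trans Kp _.
apply: card_le_trans (subset_card_le UU) _.
apply: card_le_trans (card_image_le _ _) _.
rewrite -(card_le_eqr (card_setT _)); apply: IH.
- by rewrite /card_lt (card_le_eqr (card_setT _)); exact: noseg.
- by rewrite (eq_finite_set (card_setT _)).
Qed.

Lemma card_seq_le (K : Type) :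
  infinite_set [set: K] -> [set: seq K] #<= [set: K].
Proof.
move=> infK; have [k _] := infinite_setN0 infK.
have /card_le_setTP[p _ pinj] := card_prod_le infK.
have /infiniteP/card_le_setTP[e _ einj] := infK.
pose code := foldr (fun x y => p (x, y)) k.
apply/card_le_setTP; exists (fun s => p (e (size s), code s)) => // s t.
move=> /pinj[/einj].
by elim: s t => [|x s IH] [|y t] //= [/IH{}IH] /pinj[-> /IH ->].
Qed.

Lemma card_bigcup_le (I T K : Type) (A : I -> set T) : infinite_set [set: K] ->
  [set: I] #<= [set: K] -> (forall i, A i #<= [set: K]) ->
  \bigcup_i A i #<= [set: K].
Proof.
elim/Ppointed: K => K; first by rewrite emptyE => /(_ (finite_set0 _)).
move=> infK /card_le_setTP[g _ ginj] AK.
have /choice[f finj] : forall i, exists f : T -> K, {in A i &, injective f}.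
  by move=> i; exact/pcard_injP.
have /card_le_setTP[p _ pinj] := card_prod_le infK.
pose graph := [set it : I * T | A it.1 it.2].
apply: (@card_le_trans _ _ _ graph).
  apply: card_le_trans (card_image_le snd graph).
  by apply: subset_card_le => t [i _ Ait]; exists (i, t).
apply/pcard_injP; exists (fun it => p (g it.1, f it.1 it.2)).
move=> [i t] [j u] /set_mem/= At /set_mem/= Au /pinj[/ginj ij].
by rewrite -ij in Au * => /finj->//; exact/mem_set.
Qed.

Lemma small_closed_superset (T K : Type) (E : T -> set T) (x : T) :
  infinite_set [set: K] -> (forall y, E y #<= [set: K]) ->
  exists H : set T, [/\ H x, forall y, H y -> E y `<=` H & H #<= [set: K]].
Proof.
move=> infK EK.
have /choice[e eE] : forall y, exists e : K -> T, E y `<=` range e.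
  move=> y; have /pfcard_geP[->|[e]] := EK y; first by exists (fun=> y).
  by exists e; exact: surj.
exists (range (foldl e x)); split.
- by exists [::].
- move=> _ [s _ <-] z /eE[k _ <-].
  by exists (rcons s k); rewrite ?foldl_rcons.
- exact: card_le_trans (card_image_le _ _) (card_seq_le infK).
Qed.

Lemma small_relation_stages (T : eqType) (K : Type) (E : T -> set T) :
  infinite_set [set: K] -> (forall y, E y #<= [set: K]) ->
  exists (R : rel T) (stage : T -> T), [/\ well_order R,
    forall y z, E y z -> R (stage z) (stage y) &
    forall x, [set y | stage y = x] #<= [set: K]].
Proof.
move=> infK EK; have [R Rwo] := well_ordering_principle T.
have /choice[hull hullP] := fun x => small_closed_superset x infK EK.
have /choice[stage stageP] :
    forall y, exists x, hull x y /\ forall z, hull z y -> R x z.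
  move=> y.
  have [|x xy xmin] := well_order_minimum Rwo (A := [set x | hull x y]).
    by exists y; have [] := hullP y.
  by exists x.
exists R, stage; split=> // [y z yz|x].
  have [_ closed _] := hullP (stage y); apply: (stageP z).2.
  by apply: closed yz; exact: (stageP y).1.
have [_ _] := hullP x; apply: card_le_trans; apply: subset_card_le => y <-.
exact: (stageP y).1.
Qed.

Lemma fiberwise_injective_choice (T U K C : Type) (h : T -> U)
    (L : T -> set C) :
  (forall u, h @^-1` [set u] #<= [set: K]) -> (forall x, [set: K] #<= L x) ->
  exists2 f : T -> C, forall x, L x (f x) &
    forall u, {in h @^-1` [set u] &, injective f}.
Proof.
elim/Ppointed: K => K hK KL.
  have noT (x : T) : False.
    have := hK (h x); rewrite emptyE => /eqP hx0.
    by suff : set0 x by []; rewrite -hx0.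
  by exists (fun x => match noT x with end) => [x|u x]; case: (noT x).
have [R Rwo noseg] := initial_well_order K.
have /choice[e einj] : forall u, exists e : T -> K,
    {in h @^-1` [set u] &, injective e}.
  by move=> u; exact/pcard_injP.
pose lt x y := h x = h y /\ strict R (e (h y) x) (e (h y) y).
have lt_wf : well_founded lt.
  apply: (@wf_incl _ _ (fun x y => strict R (e (h x) x) (e (h y) y))).
    by move=> x y [-> xy].
  exact: (wf_inverse_image _ _ (strict R) _ (strict_well_founded Rwo)).
have [|f fL fneq] := greedy_choice (L := L) lt_wf.
  move=> x Lx; apply: (noseg (e (h x) x)).
  apply: card_le_trans (KL x) (card_le_trans Lx _).
  rewrite -(card_le_eql (inj_card_eq (f := e (h x)) _)).
    by apply: subset_card_le => _ [y [_ xy] <-].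
  by move=> y z /set_mem[hy _] /set_mem[hz _]; apply: einj; apply/mem_set.
exists f => // u x y /set_mem/= hx /set_mem/= hy fxy; apply: contrapT => nxy.
have [|xy|yx] := strict_total Rwo (x := e u x) (y := e u y).
- by move=> exy; apply/nxy/(einj u) => //; exact/mem_set.
- by apply: (fneq x y) fxy; rewrite /lt hx hy.
- by apply: (fneq y x) (esym fxy); rewrite /lt hx hy.
Qed.

Lemma least_cardinal_leP (P : Type -> Prop) (K : Type) :
  (forall K1 K2 : Type, [set: K1] #<= [set: K2] -> P K1 -> P K2) ->
  (exists2 K0, is_least_cardinal P K0 & [set: K0] #<= [set: K]) <-> P K.
Proof.
move=> Pmono; split=> [[K0 [PK0 _] K0K]|PK]; first exact: Pmono PK0.
suff [K0 K0least] : exists K0, is_least_cardinal P K0.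
  by exists K0 => //; apply: K0least.2.
elim/(well_founded_ind card_lt_well_founded): K PK => K IH PK.
have [[K1 [K1K /IH]]|/forallNP Kmin] :=
  pselect (exists K1, card_lt K1 K /\ P K1); first exact.
by exists K; split=> // K1 PK1; apply: contrapT => nKK1; apply: (Kmin K1).
Qed.

(** * Spans and circuits *)

Section FinitaryMatroidTheory.
Variables (S : choiceType) (M : finitary_matroid S).
Implicit Types (A B C X : set S) (D E F : {fset S}) (x y z : S).

Definition span A : set S :=
  [set x | exists2 D : {fset S}, [set` D] `<=` A & M (x |` D)%fset = M D].

Lemma rank_fsetU_mono D E F : (D `<=` E)%fset -> M (F `|` D)%fset = M D ->
  M (F `|` E)%fset = M E.
Proof.
move=> DE FD; have := rank_submod M (F `|` D)%fset E.
have -> : ((F `|` D) `|` E = F `|` E)%fset.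
  by rewrite -fsetUA; congr (_ `|` _)%fset; apply/fsetUidPr.
have : M D <= M ((F `|` D) `&` E)%fset.
  by apply: rank_mono; rewrite fsubsetI DE fsubsetUr.
have : M E <= M (F `|` E)%fset by apply: rank_mono; exact: fsubsetUr.
rewrite FD; lia.
Qed.

Lemma span_mono A B : A `<=` B -> span A `<=` span B.
Proof. by move=> AB x [D DA xD]; exists D => // y /DA/AB. Qed.

Lemma subset_span A : A `<=` span A.
Proof.
move=> x Ax; exists [fset x]%fset; last by rewrite fsetUid.
by move=> y /=; rewrite inE => /eqP->.
Qed.

Lemma span_fset A D : [set` D] `<=` span A ->
  exists2 E : {fset S}, [set` E] `<=` A & M (D `|` E)%fset = M E.
Proof.
elim/fset1U_rect: D => [_|x D xD IH xDA].
  by exists fset0; rewrite ?fset0U // => y /=; rewrite inE.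
have [|E EA DE] := IH; first by move=> y yD; apply: xDA; apply/fset1UP; right.
have [|E' EA' xE'] := xDA x; first by apply/fset1UP; left.
exists (E `|` E')%fset; first by move=> y /=; rewrite inE => /orP[/EA|/EA'].
rewrite -fsetUA (rank_fsetU_mono _ xE').
  by apply: rank_fsetU_mono DE; exact: fsubsetUl.
by rewrite fsubsetU // fsubsetUr orbT.
Qed.

Lemma span_trans A B : A `<=` span B -> span A `<=` span B.
Proof.
move=> AB x [D DA xD]; have [y /DA/AB//|E EB DE] := @span_fset B D.
exists E => //; apply/eqP.
rewrite eqn_leq [M E <= _]rank_mono ?fsubsetUr // andbT.
rewrite -[leqRHS]DE -(rank_fsetU_mono (fsubsetUl D E) xD) rank_mono //.
by apply: fsetUS; exact: fsubsetUr.
Qed.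

Lemma independent_sub A B : A `<=` B -> independent M B -> independent M A.
Proof. by move=> AB iB D DA; apply: iB => x /DA/AB. Qed.

Lemma independent0 : independent M set0.
Proof.
move=> D D0; have [->|[x /D0//]] := fset_0Vmem D.
by rewrite rank0 cardfs0.
Qed.

Lemma independent1 x : loop_free M -> independent M [set x].
Proof.
move=> lf D Dx; have [->|[y yD]] := fset_0Vmem D.
  by rewrite rank0 cardfs0.
have -> : D = [fset x]%fset; last by rewrite lf cardfs1.
apply/fsetP => z; rewrite inE; apply/idP/eqP => [/Dx//|->].
by rewrite -(Dx y yD).
Qed.

Lemma independent_span A x : independent M A -> A x -> ~ span (A `\ x) x.
Proof.
move=> iA Ax [D DA]; have xD : x \notin D by apply/negP => /DA[_]; apply.
rewrite iA; last by move=> y /fset1UP[->//|/DA[]].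
rewrite iA; last by move=> y /DA[].
by rewrite cardfsU1 xD; lia.
Qed.

Lemma dependentP A : ~ independent M A <->
  exists2 D : {fset S}, [set` D] `<=` A & M D < #|` D|.
Proof.
split=> [/existsNP[D /not_implyP[DA MD]]|[D DA MD] /(_ D DA)]; last by lia.
by exists D => //; have := rank_card M D; move/eqP: MD; lia.
Qed.

Lemma circuit_fset C : circuit M C ->
  exists2 D : {fset S}, C = [set` D] & M D < #|` D|.
Proof.
move=> [/dependentP[D DC MD] Cmin]; exists D => //; apply/esym/Cmin => //.
by apply/dependentP; exists D.
Qed.

Lemma circuit_finite C : circuit M C -> finite_set C.
Proof. by move=> /circuit_fset[D -> _]; exact: finite_fset. Qed.

Lemma proper_circuit_independent C A :
  circuit M C -> A `<` C -> independent M A.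
Proof.
move=> [_ Cmin] [AC nCA]; apply: contrapT => niA.
by apply: nCA; rewrite (Cmin A AC niA).
Qed.

Lemma circuit_neq0 C : circuit M C -> C !=set0.
Proof.
move=> [ndep _]; apply/set0P/eqP => C0.
by apply: ndep; rewrite C0; exact: independent0.
Qed.

Lemma circuit_span C x : circuit M C -> C x -> span (C `\ x) x.
Proof.
move=> cC Cx; have [D CD MD] := circuit_fset cC.
have xD : x \in D by move: Cx; rewrite CD.
exists (D `\ x)%fset; first by move=> y; rewrite CD /= !inE => /andP[/eqP].
have MDx : M (D `\ x)%fset = #|` D `\ x|%fset.
  apply: (proper_circuit_independent cC (A := C `\ x)); last first.
    by move=> y; rewrite CD /= !inE => /andP[/eqP].
  by split=> [y []//|/(_ x Cx)[_]]; apply.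
have := rank_mono M (fsubD1set D x).
by move: MD; rewrite fsetD1K // (cardfsD1 x D) xD MDx; lia.
Qed.

Lemma dependent_circuit A :
  ~ independent M A -> exists2 C, circuit M C & C `<=` A.
Proof.
move=> /dependentP[D0 D0A MD0].
pose card_dependent n := `[< exists D : {fset S},
  [/\ [set` D] `<=` A, M D < #|` D| & #|` D| = n] >].
have ex_card : exists n, card_dependent n.
  by exists #|` D0|; apply/asboolP; exists D0.
case: (ex_minnP ex_card) => n /asboolP[D [DA MD Dn]] nmin.
exists [set` D] => //; split=> [|B BD]; first by apply/dependentP; exists D.
move=> /dependentP[E EB ME].
have ED : (E `<=` D)%fset by apply/fsubsetP => y /EB/BD.
have nE : n <= #|` E|.
  by apply: nmin; apply/asboolP; exists E; split=> // y /EB/BD/DA.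
have EDE : E = D by apply/eqP; rewrite eqEfcard ED Dn.
by apply/seteqP; split=> //; rewrite -EDE.
Qed.

(** * Bases *)

Lemma fset_sub_chain_bigcup (F : set (set S)) D :
  F !=set0 -> total_on F subset ->
  [set` D] `<=` \bigcup_(X in F) X -> exists2 X, F X & [set` D] `<=` X.
Proof.
move=> [X0 FX0] totF; elim/fset1U_rect: D => [_|x D _ IH xDF].
  by exists X0 => // x /=; rewrite inE.
have [|X FX DX] := IH; first by move=> y yD; apply: xDF; apply/fset1UP; right.
have [|Y FY Yx] := xDF x; first by apply/fset1UP; left.
have [XY|YX] := totF _ _ FX FY.
  by exists Y => // y /fset1UP[->//|/DX/XY].
by exists X => // y /fset1UP[->|/DX//]; exact: YX.
Qed.

Lemma bigcup_independent (F : set (set S)) : total_on F subset ->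
  (forall X, F X -> independent M X) -> independent M (\bigcup_(X in F) X).
Proof.
move=> totF iF; have [->|/set0P F0] := eqVneq F set0.
  by rewrite bigcup_set0; exact: independent0.
by move=> D /(fset_sub_chain_bigcup F0 totF)[X /iF]; exact.
Qed.

Lemma independent_sub_base X :
  independent M X -> exists2 B, base M B & X `<=` B.
Proof.
move=> iX.
have [F iF totF|Y [iYX Ymax]] :=
  @Zorn_bigcup _ [set Y | independent M (Y `|` X)].
  rewrite /=; pose G := X |` [set Y `|` X | Y in F].
  apply: (independent_sub (B := \bigcup_(Z in G) Z)).
    move=> x [[Y FY Yx]|Xx]; last by exists X; [left|].
    by exists (Y `|` X); [right; exists Y|left].
  apply: bigcup_independent => [|_ [->//|[Y /iF iYX <-//]]].
  move=> _ _ [->|[Y FY <-]] [->|[Z FZ <-]].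
  - by left.
  - by left=> x; right.
  - by right=> x; right.
  - by have [YZ|ZY] := totF _ _ FY FZ; [left|right]; exact: setSU.
exists (Y `|` X); last by move=> x; right.
split=> // Z iZ YXZ; apply: contrapT => nZ.
apply: (Ymax Z); last by rewrite /= setUidl // => x Xx; apply: YXZ; right.
split=> [y Yy|ZY]; first by apply: YXZ; left.
by apply: nZ; apply/seteqP; split=> // x /ZY; left.
Qed.

Lemma main_circleP B x : base M B -> ~ B x ->
  circuit M (main_circle M B x) /\ main_circle M B x `<=` x |` B.
Proof.
move=> [iB Bmax] nBx.
suff : [set C | circuit M C /\ C `<=` x |` B] (main_circle M B x) by [].
apply: xgetPex.
have [|C cC CB] := @dependent_circuit (x |` B); last by exists C.
by move=> ixB; apply: nBx; rewrite -(Bmax _ ixB); [left|move=> y; right].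
Qed.

Lemma main_circle_mem B x : base M B -> ~ B x -> main_circle M B x x.
Proof.
move=> bB nBx; have [[ndep _] Cx] := main_circleP bB nBx.
apply: contrapT => nCx; apply: ndep; apply: independent_sub bB.1 => y Cy.
by have [yx|//] := Cx y Cy; rewrite yx in Cy.
Qed.

(** * Supports *)

Definition support B x : set S :=
  if x \in B then [set x] else main_circle M B x `&` B.

Lemma support_sub B x : support B x `<=` B.
Proof.
by rewrite /support; case: ifPn => [/set_mem Bx y ->//|_]; exact: subIsetr.
Qed.

Lemma main_circle_support B x : base M B -> ~ B x ->
  main_circle M B x = x |` support B x.
Proof.
move=> bB nBx; have [_ Cx] := main_circleP bB nBx.
rewrite /support memNset //; apply/seteqP; split=> y => [Cy|[->|[]//]].
  by have [->|By] := Cx y Cy; [left|right].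
exact: main_circle_mem.
Qed.

Lemma support_finite B x : base M B -> finite_set (support B x).
Proof.
move=> bB; have [Bx|nBx] := pselect (B x).
  by rewrite /support mem_set //; exact: finite_set1.
rewrite /support memNset //; apply: finite_setIl; apply: circuit_finite.
exact: (main_circleP bB nBx).1.
Qed.

Lemma support_neq0 B x : loop_free M -> base M B -> support B x !=set0.
Proof.
move=> lf bB; have [Bx|nBx] := pselect (B x).
  by exists x; rewrite /support mem_set.
apply/set0P/eqP => supp0; have [[ndep _] _] := main_circleP bB nBx; apply: ndep.
by rewrite main_circle_support // supp0 setU0; exact: independent1.
Qed.

Lemma span_support B x : base M B -> span (support B x) x.
Proof.
move=> bB; have [Bx|nBx] := pselect (B x).
  by apply: subset_span; rewrite /support mem_set.
have := circuit_span (main_circleP bB nBx).1 (main_circle_mem bB nBx).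
by rewrite main_circle_support //; apply: span_mono => y [[|]].
Qed.

Lemma support_exchange B x b : base M B -> support B x b ->
  span (x |` support B x `\ b) b.
Proof.
move=> bB xb; have [Bx|nBx] := pselect (B x).
  by move: xb; rewrite /support mem_set // => ->; apply: subset_span; left.
have := circuit_span (x := b) (main_circleP bB nBx).1.
rewrite main_circle_support // => /(_ (or_intror xb)); apply: span_mono.
by move=> y [[->|xy] yb]; [left|right].
Qed.

(* The part of T inside a base of the cover spans T, so a point of that base
   lying in the span of T cannot be outside T. *)
Lemma support_closed_flat (I : Type) (B_ : I -> set S) (T : set S) :
  (forall i, base M (B_ i)) -> (forall x, exists i, B_ i x) ->
  (forall i x, T x -> support (B_ i) x `<=` T) -> span T `<=` T.
Proof.
move=> bB cover closed x Tx; apply: contrapT => nTx; have [i Bx] := cover x.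
apply: (independent_span (bB i).1 Bx).
have : span (T `&` B_ i) x.
  apply: span_trans Tx => y Ty.
  apply: span_mono (span_support y (bB i)) => z yz.
  by split; [exact: closed yz|exact: support_sub yz].
by apply: span_mono => y [Ty By]; split=> // yx; apply: nTx; rewrite -yx.
Qed.

Section MainMax.
Variables (B : set S) (le : rel S).
Hypotheses (lf : loop_free M) (woB : well_ordered_base M B le).

Lemma main_max_maximum x :
  maximum_of le (mem (support B x)) (main_max M B le x).
Proof.
have [bB wo] := woB.
have [|m mmax] := wo_chain_finite_maximum wo (support_finite x bB)
    (support_neq0 x lf bB).
  by move=> y /set_mem/support_sub/mem_set.
move: m mmax; rewrite /main_max /support; case: ifPn => [xB _ _|_ m mmax].
  split; first exact/mem_set.
  by move=> y /set_mem->; apply: (wo_chain_reflexive wo).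
exact: (xgetPex x (ex_intro _ m mmax)).
Qed.

Lemma main_max_support x : support B x (main_max M B le x).
Proof. exact/set_mem/(main_max_maximum x).1. Qed.

Lemma le_main_max x b : support B x b -> le b (main_max M B le x).
Proof. by move=> /mem_set; exact: (main_max_maximum x).2. Qed.

Lemma main_max_base x : B (main_max M B le x).
Proof. exact/(support_sub (B := B))/main_max_support. Qed.

Definition upto (m : S) : set S := [set b | B b /\ le b m].

Lemma support_upto_main_max x : support B x `<=` upto (main_max M B le x).
Proof. by move=> b xb; split; [exact: support_sub xb|exact: le_main_max]. Qed.

Lemma upto_lt b m : B b -> B m -> le b m -> b <> m -> upto b `<=` upto m `\ m.
Proof.
have [_ wo] := woB => Bb Bm bm nbm a [Ba ab]; split=> [|am].
  by split=> //; apply: (wo_chain_transitive wo) ab bm; exact/mem_set.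
apply: nbm; apply: (wo_chain_antisymmetric wo); try exact/mem_set.
by rewrite bm -am.
Qed.

Lemma span_upto_main_max x : span (upto (main_max M B le x)) x.
Proof.
exact: span_mono (@support_upto_main_max x) _ (span_support x woB.1).
Qed.

Lemma main_max_exchange x (m := main_max M B le x) :
  span (x |` upto m `\ m) m.
Proof.
apply: span_mono (support_exchange woB.1 (main_max_support x)).
apply: setUS; apply: setSD; exact: support_upto_main_max.
Qed.

(* In a circuit, the element with the largest value m of main_max would put m
   into the span of the smaller elements of the base. *)
Lemma main_max_inj_independent (X : set S) :
  {in X &, injective (main_max M B le)} -> independent M X.
Proof.
move=> mm_inj; have [bB wo] := woB; set mm := main_max M B le.
apply: contrapT => /dependent_circuit[C cC CX].
have [|||_ [/set_mem[x Cx <-] xmax]] :=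
  wo_chain_finite_maximum (A := mm @` C) wo.
- exact/finite_image/circuit_finite.
- by have [y Cy] := circuit_neq0 cC; exists (mm y), y.
- by move=> _ /set_mem[y _ <-]; exact/mem_set/main_max_base.
have below_x : span (upto (mm x) `\ mm x) x.
  apply: span_trans (circuit_span cC Cx) => y [Cy nyx].
  apply: span_mono (span_upto_main_max y); apply: upto_lt.
  - exact: main_max_base.
  - exact: main_max_base.
  - by apply/xmax/mem_set; exists y.
  - by move=> yx; apply/nyx/mm_inj => //; exact/mem_set/CX.
apply: (independent_span bB.1 (main_max_base x)).
apply: (@span_mono (upto (mm x) `\ mm x)); first by move=> b [[]].
apply: span_trans (main_max_exchange x) => b [->//|]; exact: subset_span.
Qed.

End MainMax.

(** * Colorings *)

Lemma main_max_list_colorable (K : Type) B le : loop_free M ->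
  well_ordered_base M B le ->
  (forall b, B b -> [set x | main_max M B le x = b] #<= [set: K]) ->
  list_colorable M K.
Proof.
move=> lf woB small C L LK.
have [b|f fL finj] :=
  @fiberwise_injective_choice _ _ K C (main_max M B le) L _ LK.
  have [/small//|nBb] := pselect (B b).
  suff -> : main_max M B le @^-1` [set b] = set0 by exact: card_ge0.
  by rewrite -subset0 => x /= xb; apply: nBb; rewrite -xb; exact: main_max_base.
exists f; split=> // c; apply: (main_max_inj_independent lf woB).
move=> x y /set_mem/= fx /set_mem/= fy xy.
by apply: (finj (main_max M B le x)); rewrite ?fx ?fy //; apply/mem_set.
Qed.

(* The points whose stage is at most that of main_max x form a flat, because
   supports never leave this set; it contains the support of x, hence x. *)
Lemma main_max_stage (I : Type) (B_ : I -> set S) (R : rel S) (stage : S -> S)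
    (le : rel S) i x : loop_free M ->
  (forall j, base M (B_ j)) -> (forall y, exists j, B_ j y) ->
  well_order R -> (forall j y z, support (B_ j) y z -> R (stage z) (stage y)) ->
  well_order le -> (forall y z, le y z -> R (stage y) (stage z)) ->
  stage (main_max M (B_ i) le x) = stage x.
Proof.
move=> lf bB cover Rwo supp_stage lewo le_stage.
have woB : well_ordered_base M (B_ i) le by split=> //; exact: withinW.
set b := main_max M (B_ i) le x.
apply: (well_order_anti Rwo); rewrite (supp_stage i x) /=; last first.
  exact: main_max_support.
pose below := [set y | R (stage y) (stage b)].
suff : below x by [].
apply: (support_closed_flat bB cover) => [j y yb z /supp_stage zy|].
  exact: (well_order_trans Rwo zy).
apply: span_mono (span_support x (bB i)) => y xy.
by apply: le_stage; exact: le_main_max.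
Qed.

Lemma colorable_main_max (K : Type) : loop_free M -> infinite_set [set: K] ->
  colorable M K -> exists (B : set S) (le : rel S), well_ordered_base M B le /\
    forall b, B b -> [set x | main_max M B le x = b] #<= [set: K].
Proof.
move=> lf infK [Phi PhiP]; have [k _] := infinite_setN0 infK.
have /choice[B_ B_P] : forall i, exists B, base M B /\ Phi @^-1` [set i] `<=` B.
  by move=> i; have [B bB iB] := independent_sub_base (PhiP i); exists B.
have bB i : base M (B_ i) := (B_P i).1.
have cover x : exists i, B_ i x by exists (Phi x); exact: (B_P (Phi x)).2.
have [|R [stage [Rwo supp_stage stageK]]] :=
  small_relation_stages (E := fun x => \bigcup_i support (B_ i) x) infK.
  move=> x; apply: card_bigcup_le => // i.
  apply: card_le_trans (finite_set_countable (support_finite x (bB i))) _.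
  exact/infiniteP.
have [Q Qwo] := well_ordering_principle S.
have lexi_wo := lexi_well_order stage Rwo Qwo.
exists (B_ k), (lexi stage R Q); split=> [|b _].
  by split=> //; exact: withinW.
apply: card_le_trans (stageK (stage b)); apply: subset_card_le => x /= <-.
apply/esym/(main_max_stage k x lf bB cover Rwo _ lexi_wo).
  by move=> j y z yz; apply: supp_stage; exists j.
by move=> y z /andP[].
Qed.

Lemma colorable_mono (K1 K2 : Type) : [set: K1] #<= [set: K2] ->
  colorable M K1 -> colorable M K2.
Proof.
move=> /card_le_setTP[f _ finj] [Phi PhiP]; exists (f \o Phi) => i.
have [[x fx]|/forallNP nfx] := pselect (exists x, f (Phi x) = i).
  by apply: independent_sub (PhiP (Phi x)) => y /= fy; apply: finj; rewrite fx.
by apply: (independent_sub _ independent0) => x /nfx.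
Qed.

Lemma list_colorable_mono (K1 K2 : Type) : [set: K1] #<= [set: K2] ->
  list_colorable M K1 -> list_colorable M K2.
Proof.
by move=> K12 lc C L LK; apply: lc => x; apply: card_le_trans K12 (LK x).
Qed.

Lemma list_colorable_colorable (K : Type) : list_colorable M K -> colorable M K.
Proof. by move=> /(_ K (fun=> setT))[x|Phi [PhiP _]]; [|exists Phi]. Qed.

End FinitaryMatroidTheory.

Theorem theorem2 (S : choiceType) (M : finitary_matroid S) (K : Type)
  (hM : loop_free M) (hK : infinite_set [set: K]) :
  (Chr_le M K <-> List_le M K) /\
  (List_le M K <->
     exists (B : set S) (le : rel S),
       well_ordered_base M B le /\
       forall b : S, B b -> [set x : S | main_max M B le x = b] #<= [set: K]).
Proof.
have chrP : Chr_le M K <-> colorable M K.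
  exact/least_cardinal_leP/colorable_mono.
have listP : List_le M K <-> list_colorable M K.
  exact/least_cardinal_leP/list_colorable_mono.
rewrite chrP listP; split; split.
- move=> /(colorable_main_max hM hK)[B [le [woB small]]].
  exact: main_max_list_colorable small.
- exact: list_colorable_colorable.
- by move=> /list_colorable_colorable/(colorable_main_max hM hK).
- by move=> [B [le [woB small]]]; exact: main_max_list_colorable small.
Qed.
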